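(* Let $d\in\mathbb{N}$ and $\alpha\in(0,2)$ with $\alpha<d<2\alpha$, and let $\gamma\in\mathbb{R}$. The potential $V(x)=|x|^{-\alpha}(-\log|x|)^{-\gamma}\mathbf{1}_{\{|x|<1/2\}}$ on $\mathbb{R}^d$ belongs to $\mathcal{R}_{d,\alpha}$ if and only if $\gamma>\frac12$.
   Context: The fractional Rollnik-class $\mathcal{R}_{d,\alpha}$ (for $0<\alpha<2$, $\alpha<d<2\alpha$) is the set of measurable functions $V$ on $\mathbb{R}^d$ with $$\|V\|^2_{\mathcal{R}_{d,\alpha}}=\int_{\mathbb{R}^d}\int_{\mathbb{R}^d}\frac{|V(x)||V(y)|}{|x-y|^{2(d-\alpha)}}\,dx\,dy<\infty .$$ *)

(* Defs.v *)
From HB Require Import structures.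
From mathcomp Require Import all_boot all_order all_algebra.
From mathcomp Require Import all_classical all_reals all_analysis.
From mathcomp Require Import measurable_realfun.

Set Implicit Arguments.
Unset Strict Implicit.
Unset Printing Implicit Defensive.
Import Order.TTheory GRing.Theory Num.Theory.
Import numFieldNormedType.Exports.

Local Open Scope classical_set_scope.
Local Open Scope ring_scope.

Definition tcons (R : realType) (n : nat) (p : measurableTypeR R * n.-tuple R) :
  n.+1.-tuple R := [the n.+1.-tuple R of p.1 :: p.2].

Lemma measurable_tcons (R : realType) (n : nat) :
  measurable_fun setT (@tcons R n).
Proof. by apply: measurable_cons. Qed.

(* The library does not provide Lebesgue measure on R^n; it is built below by
   induction on n as the image of (Lebesgue measure on R) x (Lebesgue measure
   on R^n) under the identification of R * R^n with R^(n+1). The sigma-algebra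
   on n.-tuple R is the library's product of the Borel sigma-algebras. *)
Definition leb_tcons (R : realType) (n : nat)
    (mu : {sigma_finite_measure set (n.-tuple R) -> \bar R}) :
    set (n.+1.-tuple R) -> \bar R :=
  pushforward (lebesgue_measure \x mu)%E (@tcons R n).

Section leb_tcons_measure.
Context (R : realType) (n : nat).
Variable mu : {sigma_finite_measure set (n.-tuple R) -> \bar R}.
Local Open Scope ereal_scope.

Let leb_tcons0 : leb_tcons mu set0 = 0.
Proof. by rewrite /leb_tcons measure0//; exact: measurable_tcons. Qed.

Let leb_tcons_ge0 A : 0 <= leb_tcons mu A.
Proof. by rewrite /leb_tcons measure_ge0//; exact: measurable_tcons. Qed.

Let leb_tcons_sigma_additive : semi_sigma_additive (leb_tcons mu).
Proof.
by apply: measure_semi_sigma_additive; exact: measurable_tcons.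
Qed.

HB.instance Definition _ := isMeasure.Build _ _ _ (leb_tcons mu)
  leb_tcons0 leb_tcons_ge0 leb_tcons_sigma_additive.

Let leb_tcons_sigma_finite : sigma_finite setT (leb_tcons mu).
Proof.
have /sigma_finiteP[F [TF ndF Foo]] := sigma_finiteT (@lebesgue_measure R).
have /sigma_finiteP[G [TG ndG Goo]] := sigma_finiteT mu.
have mhead : measurable_fun setT (fun t : n.+1.-tuple R => thead t).
  exact: measurable_tnth.
have mtail : measurable_fun setT (fun t : n.+1.-tuple R => [tuple of behead t]).
  exact: measurable_behead.
exists (fun k => ((fun t : n.+1.-tuple R => thead t) @^-1` F k) `&`
                 ((fun t : n.+1.-tuple R => [tuple of behead t]) @^-1` G k)).
  apply/esym; rewrite -subTset => t _.
  have : setT (thead t) by [].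
  rewrite TF => -[i _ Fi].
  have : [set: n.-tuple R] [tuple of behead t] by [].
  rewrite TG => -[j _ Gj]; exists (maxn i j) => //; split => /=.
    by apply: (subsetPset _ _ (ndF _ _ (leq_maxl i j))).
  by apply: (subsetPset _ _ (ndG _ _ (leq_maxr i j))).
move=> k; have [mF Fk] := Foo k; have [mG Gk] := Goo k; split.
  by apply: measurableI; rewrite -[X in measurable X]setTI;
    [exact: mhead|exact: mtail].
rewrite /leb_tcons /pushforward.
rewrite (_ : _ @^-1` _ = F k `*` G k).
  by rewrite product_measure1E// lte_mul_pinfty// ge0_fin_numE.
apply/seteqP; split=> -[x t] /=.
  rewrite theadE (_ : [tuple of _] = t)//; exact/val_inj.
rewrite theadE (_ : [tuple of _] = t)//; exact/val_inj.
Qed.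

HB.instance Definition _ := Measure_isSigmaFinite.Build _ _ _ (leb_tcons mu)
  leb_tcons_sigma_finite.
End leb_tcons_measure.

Fixpoint lebesgue_tuple (R : realType) (n : nat) :
    {sigma_finite_measure set (n.-tuple R) -> \bar R} :=
  if n is m.+1 then leb_tcons (lebesgue_tuple R m)
  else \d_([tuple] : 0.-tuple R).

(* This determines lebesgue_tuple R n on the Borel sets. *)
Lemma lebesgue_tuple_box (R : realType) (n : nat) (A : 'I_n -> set R) :
  (forall i, measurable (A i)) ->
  lebesgue_tuple R n [set t | forall i, A i (tnth t i)] =
  (\prod_(i < n) lebesgue_measure (A i))%E.
Proof.
elim: n A => [|n IH] A mA.
  rewrite big_ord0 /= diracE mem_set// => -[]//.
rewrite big_ord_recl -IH//= /leb_tcons /pushforward.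
have -> : @tcons R n @^-1` [set t | forall i, A i (tnth t i)] =
    A ord0 `*` [set t : n.-tuple R | forall i, A (lift ord0 i) (tnth t i)].
  apply/seteqP; split=> -[x t] /=.
    by move=> h; split; [exact: h ord0|move=> i; move: (h (lift ord0 i)); rewrite /tcons tnthS].
  by move=> [h0 h] i; case: (unliftP ord0 i) => [j|] ->; rewrite /tcons ?tnthS// tnth0.
have mB : measurable
    [set t : n.-tuple R | forall i, A (lift ord0 i) (tnth t i)].
  rewrite (_ : [set t | _] = \bigcap_(i in [set: 'I_n])
      ((fun t : n.-tuple R => tnth t i) @^-1` A (lift ord0 i))).
    apply: fin_bigcap_measurable => // i _.
    by rewrite -[X in measurable X]setTI; apply: measurable_tnth.
  by apply/seteqP; split=> t /= h i; [move=> _|]; exact: h.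
exact: (product_measure1E lebesgue_measure (lebesgue_tuple R n) (mA ord0) mB).
Qed.

Definition enorm (R : realType) (d : nat) (x : d.-tuple R) : R :=
  Num.sqrt (\sum_(i < d) tnth x i ^+ 2).

Definition tsub (R : realType) (d : nat) (x y : d.-tuple R) : d.-tuple R :=
  [tuple tnth x i - tnth y i | i < d].

(* Preimages of Borel sets lie in the completed (Lebesgue) sigma-algebra
   of R^d, not just in the Borel one. *)
Definition lebesgue_measurable_fun (R : realType) (d : nat)
    (V : d.-tuple R -> R) : Prop :=
  forall B : set R, measurable B ->
    completed_algebra_gen (lebesgue_tuple R d) (V @^-1` B).

(* On the diagonal x = y the kernel takes the junk value 0 (as 0^-1 = 0) instead
   of +oo; the diagonal is a null set for d > 0. The library's integral of a
   nonnegative function is a supremum over Borel simple functions below it, so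
   it gives the usual value for Lebesgue measurable integrands as well. *)
Definition rollnik_sqnorm (R : realType) (d : nat) (alpha : R)
    (V : d.-tuple R -> R) : \bar R :=
  (\int[lebesgue_tuple R d]_x \int[lebesgue_tuple R d]_y
     (`|V x| * `|V y| / enorm (tsub x y) `^ (2 * (d%:R - alpha)))%:E)%E.

Definition rollnik (R : realType) (d : nat) (alpha : R) :
    set (d.-tuple R -> R) :=
  [set V | lebesgue_measurable_fun V /\ (rollnik_sqnorm alpha V < +oo)%E].

Arguments rollnik {R} d alpha.

(* At x = 0, where the formula is meaningless, the conventions for powR and ln
   give the value 0 (when alpha != 0). *)
Definition log_potential (R : realType) (d : nat) (alpha gamma : R)
    (x : d.-tuple R) : R :=
  enorm x `^ (- alpha) * (- ln (enorm x)) `^ (- gamma) *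
  \1_[set y : d.-tuple R | enorm y < 1 / 2] x.

(* Main.v *)
Require Import Defs.
From mathcomp Require Import all_boot all_order all_algebra.
From mathcomp Require Import all_classical all_reals all_analysis.
From mathcomp Require Import measurable_realfun ring lra.

(* Write b = 2(d - alpha) and w(x) = (-log|x|)^-gamma.

   Upper bound (gamma > 1/2): by symmetry and Tonelli it suffices to integrate
   over |y| <= |x|. There w(y) <= w(x), so V(x)V(y) is at most
   w(x)^2 |x|^-alpha |y|^-alpha, and the integral over |y| <= |x| of
   |y|^-alpha |x - y|^-b is at most C |x|^(d - alpha - b) = C |x|^(alpha - d),
   since near each of its two singularities only one factor is singular, with
   exponent below d. What remains is the integral of |x|^-d w(x)^2 over
   |x| < 1/2, whose dyadic shells contribute terms of order k^(-2 gamma).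

   Lower bound (gamma <= 1/2): on two consecutive dyadic boxes at distance about
   2^-k from the origin every factor of the kernel has its expected size, the
   powers of 2^k cancel, and the pair contributes at least c / k. Distinct boxes
   are used for x and y in order to stay away from the diagonal, where the
   integrand takes the junk value 0. *)

Set Implicit Arguments.
Unset Strict Implicit.
Unset Printing Implicit Defensive.
Import Order.TTheory GRing.Theory Num.Theory.
Import numFieldNormedType.Exports.

Local Open Scope classical_set_scope.
Local Open Scope ring_scope.

(** * Numerical series *)

Lemma nneseries_le_partial (R : realType) (u : nat -> R) (M : R) :
  (forall k, 0 <= u k) -> (forall n, \sum_(0 <= k < n) u k <= M) ->
  (\sum_(0 <= k <oo) (u k)%:E <= M%:E)%E.
Proof.
move=> u0 uM; apply: lime_le.
  by apply: is_cvg_nneseries => n _ _; rewrite lee_fin.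
by apply: nearW => n; rewrite sumEFin lee_fin.
Qed.

Lemma nneseries_geometric_le (R : realType) (c q : R) :
  0 <= c -> 0 <= q < 1 ->
  (\sum_(0 <= k <oo) (c * q ^+ k)%:E <= (c / (1 - q))%:E)%E.
Proof.
move=> c0 /andP[q0 q1]; apply: nneseries_le_partial => [k|n].
  by rewrite mulr_ge0// exprn_ge0.
have := @geometric_seriesE R c q; rewrite lt_eqF// => /(_ isT).
move=> /(congr1 (fun f => f n)).
rewrite /series /geometric /= => ->.
rewrite ler_wpM2r//; first by rewrite invr_ge0 subr_ge0 ltW.
by rewrite mulrBr mulr1 gerBl mulr_ge0// exprn_ge0.
Qed.

(** Discrete form of comparing the p-series with an integral. With [s = t / (t + 1)], the bounds
    [expR u >= 1 + u] and [ln s <= s - 1] give [s ^ (-q) >= 1 + q / (t + 1)]; multiplying by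
    [(t + 1) ^ (-q)] gives the claim. *)
Lemma powR_succ_telescope_ge (R : realType) (q t : R) : 0 < q -> 0 < t ->
  q * (t + 1) `^ (- (q + 1)) <= t `^ (- q) - (t + 1) `^ (- q).
Proof.
move=> q0 t0; have t1 : 0 < t + 1 by lra.
set s := t / (t + 1).
have s0 : 0 < s by rewrite divr_gt0.
have ts : t = s * (t + 1) by rewrite /s divfK ?gt_eqF.
have lns : (t + 1)^-1 <= - ln s.
  have : ln s <= s - 1.
    have := @le_ln1Dx R (s - 1); rewrite (_ : 1 + (s - 1) = s); last by ring.
    by apply; lra.
  have : s - 1 = - (t + 1)^-1 by rewrite /s; field; lra.
  lra.
have sq : 1 + q / (t + 1) <= s `^ (- q).
  rewrite /powR gt_eqF// (le_trans _ (expR_ge1Dx _))//.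
  by rewrite lerD2l mulNr -mulrN ler_pM2l.
have tq0 : 0 < (t + 1) `^ (- q) by exact: powR_gt0.
have -> : (t + 1) `^ (- (q + 1)) = (t + 1) `^ (- q) / (t + 1).
  rewrite opprD powRD; first by rewrite powR_inv1// ltW.
  by rewrite (gt_eqF t1) implybT.
rewrite {3}ts powRM ?(ltW s0) ?(ltW t1)//.
have : (1 + q / (t + 1)) * (t + 1) `^ (- q) <= s `^ (- q) * (t + 1) `^ (- q).
  by rewrite ler_pM2r.
lra.
Qed.

Lemma nneseries_powR_lty (R : realType) (p : R) : 1 < p ->
  (\sum_(0 <= k <oo) ((k.+1%:R : R) `^ (- p))%:E < +oo)%E.
Proof.
move=> p1; set q := p - 1; have q0 : 0 < q by rewrite /q; lra.
apply: (@le_lt_trans _ _ (1 + q^-1)%:E); last exact: ltry.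
apply: nneseries_le_partial => [k|n]; first exact: powR_ge0.
case: n => [|n]; first by rewrite big_geq// addr_ge0 ?invr_ge0 ?ltW.
(* The bound is strengthened by the tail term so that the induction step is exactly the telescoping
   inequality. *)
suff : \sum_(0 <= k < n.+1) (k.+1%:R : R) `^ (- p) <=
    1 + q^-1 * (1 - n.+1%:R `^ (- q)).
  move=> /le_trans; apply.
  by rewrite lerD2l mulrBr mulr1 gerBl mulr_ge0 ?powR_ge0 ?invr_ge0 ?ltW.
elim: n => [|n IH].
  by rewrite big_nat1 !powR1 subrr mulr0 addr0.
rewrite big_nat_recr//=.
have n0 : 0 < n.+1%:R :> R by rewrite ltr0n.
have := @powR_succ_telescope_ge R q n.+1%:R q0 n0.
rewrite natr1 (_ : q + 1 = p); last by rewrite /q subrK.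
rewrite -ler_pdivlMl// => h; apply: le_trans (lerD IH h) _.
lra.
Qed.

Lemma nneseries_harmonic (R : realType) (c : R) : 0 < c ->
  (\sum_(0 <= k <oo) (c / k.+1%:R)%:E = +oo)%E.
Proof.
move=> c0; apply/eqP; rewrite -leye_eq leNgt; apply/negP => soo.
have u0 k : 0 <= c / k.+1%:R :> R by rewrite divr_ge0// ltW.
apply: (@dvg_harmonic R).
have -> : @harmonic R = c^-1 *: (fun k => c / k.+1%:R).
  by apply/funext => k; exact/esym/(mulKf (lt0r_neq0 c0)).
by apply: is_cvg_seriesZ; exact: nnseries_is_cvg.
Qed.

(** * The Euclidean norm and the measure of boxes *)

Section enorm_theory.
Context (R : realType) (d : nat).
Implicit Types (x y : d.-tuple R) (r : R).

Lemma tnth_tsub x y i : tnth (tsub x y) i = tnth x i - tnth y i.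
Proof. by rewrite tnth_mktuple. Qed.

Lemma enorm_ge0 x : 0 <= enorm x.
Proof. exact: sqrtr_ge0. Qed.

Lemma sqr_enorm x : enorm x ^+ 2 = \sum_(i < d) tnth x i ^+ 2.
Proof. by rewrite sqr_sqrtr// sumr_ge0// => i _; exact: sqr_ge0. Qed.

Lemma norm_tnth_le_enorm x i : `|tnth x i| <= enorm x.
Proof.
rewrite -(ler_pXn2r (ltn0Sn 1)) ?nnegrE ?enorm_ge0// sqr_enorm.
rewrite real_normK ?num_real//.
by rewrite (bigD1 i)//= lerDl sumr_ge0// => j _; exact: sqr_ge0.
Qed.

Lemma enorm_le x r : 0 <= r -> (forall i, `|tnth x i| <= r) ->
  enorm x <= Num.sqrt d%:R * r.
Proof.
move=> r0 xr.
rewrite -(ler_pXn2r (ltn0Sn 1)) ?nnegrE ?enorm_ge0 ?mulr_ge0 ?sqrtr_ge0//.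
rewrite sqr_enorm exprMn sqr_sqrtr// mulr_natl.
rewrite -[d in leRHS]card_ord -sumr_const ler_sum// => i _.
by rewrite -real_normK ?num_real// ler_pXn2r ?nnegrE ?normr_ge0.
Qed.

Lemma enorm_ge x r : 0 <= r -> (forall i, r <= tnth x i) ->
  Num.sqrt d%:R * r <= enorm x.
Proof.
move=> r0 xr.
rewrite -(ler_pXn2r (ltn0Sn 1)) ?nnegrE ?enorm_ge0 ?mulr_ge0 ?sqrtr_ge0//.
rewrite sqr_enorm exprMn sqr_sqrtr// mulr_natl.
rewrite -[d in leLHS]card_ord -sumr_const ler_sum// => i _.
by rewrite ler_pXn2r ?nnegrE// (le_trans r0).
Qed.

Lemma enorm_tsubC x y : enorm (tsub x y) = enorm (tsub y x).
Proof.
by congr Num.sqrt; apply: eq_bigr => i _; rewrite !tnth_tsub -sqrrN opprB.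
Qed.

(** Lets estimates on balls with arbitrary centre be used around the origin. *)
Lemma enorm_tsub0 x : enorm (tsub [tuple 0 | _ < d] x) = enorm x.
Proof.
congr Num.sqrt; apply: eq_bigr => i _.
by rewrite tnth_tsub tnth_mktuple sub0r sqrrN.
Qed.

Lemma enorm_tsub_eq0 x y : enorm (tsub x y) = 0 -> x = y.
Proof.
move=> xy0; apply: eq_from_tnth => i; apply/eqP; rewrite -subr_eq0 -tnth_tsub.
by rewrite -normr_le0 -xy0 norm_tnth_le_enorm.
Qed.

(** This inequality and the next stand in for the triangle inequality. They hold coordinate by
    coordinate, so Cauchy-Schwarz is avoided, and their constants still give the sharp factor 2 in
    [enorm_tsub_le] and [enorm_tsub_ge]. *)
Lemma sqr_enorm_tsub_le x y :
  enorm (tsub x y) ^+ 2 <= 2 * enorm x ^+ 2 + 2 * enorm y ^+ 2.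
Proof.
rewrite !sqr_enorm !mulr_sumr -big_split ler_sum// => i _ /=.
rewrite tnth_tsub; have := sqr_ge0 (tnth x i + tnth y i); nra.
Qed.

Lemma sqr_enorm_le_tsub x y :
  enorm x ^+ 2 <= 2 * enorm (tsub x y) ^+ 2 + 2 * enorm y ^+ 2.
Proof.
rewrite !sqr_enorm !mulr_sumr -big_split ler_sum// => i _ /=.
(* In each coordinate the two sides differ by exactly the square of [x - 2 y]. *)
rewrite tnth_tsub; have := sqr_ge0 (tnth x i - tnth y i *+ 2); nra.
Qed.

Lemma enorm_tsub_le x y r : enorm x <= r -> enorm y <= r ->
  enorm (tsub x y) <= 2 * r.
Proof.
move=> xr yr; have x0 := enorm_ge0 x; have y0 := enorm_ge0 y.
rewrite -(ler_pXn2r (ltn0Sn 1)) ?nnegrE ?enorm_ge0 ?mulr_ge0// ?(le_trans x0)//.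
by have := sqr_enorm_tsub_le x y; nra.
Qed.

Lemma enorm_tsub_ge x y r : 2 * r <= enorm x -> enorm y <= r ->
  r <= enorm (tsub x y).
Proof.
move=> xr yr; have x0 := enorm_ge0 x; have y0 := enorm_ge0 y.
rewrite -(ler_pXn2r (ltn0Sn 1)) ?nnegrE ?enorm_ge0 ?(le_trans y0)//.
by have := sqr_enorm_le_tsub x y; nra.
Qed.

Lemma measurable_enorm : measurable_fun setT (@enorm R d).
Proof.
have mS : measurable_fun setT (fun x => \sum_(i < d) tnth x i ^+ 2).
  by apply: measurable_sum => i; apply: measurable_funX; exact: measurable_tnth.
rewrite (_ : @enorm R d =
    (@powR R ^~ 2^-1) \o (fun x => \sum_(i < d) tnth x i ^+ 2)).
  exact: measurableT_comp.
apply/funext => x /=; rewrite powR12_sqrt// sumr_ge0// => i _.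
exact: sqr_ge0.
Qed.

Lemma measurable_enorm_lt r : measurable [set x : d.-tuple R | enorm x < r].
Proof.
rewrite -[X in measurable X]setTI.
exact: (measurable_fun_ltr measurable_enorm (measurable_cst r)).
Qed.

Lemma measurable_enorm_powR (c : R) :
  measurable_fun setT (fun x : d.-tuple R => enorm x `^ c).
Proof. exact: (measurableT_comp (@measurable_powR R c) measurable_enorm). Qed.

Lemma measurable_ln_enorm_powR (c : R) :
  measurable_fun setT (fun x : d.-tuple R => (- ln (enorm x)) `^ c).
Proof.
apply: (measurableT_comp (@measurable_powR R c)); apply: measurable_funN.
exact: (measurableT_comp (@measurable_ln R) measurable_enorm).
Qed.

Lemma measurable_enorm_tsub :
  measurable_fun setT (fun p : d.-tuple R * d.-tuple R => enorm (tsub p.1 p.2)).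
Proof.
apply: (measurableT_comp measurable_enorm).
apply/measurable_fun_tnthP => i.
rewrite (_ : _ \o _ =
    (fun p : d.-tuple R * d.-tuple R => tnth p.1 i - tnth p.2 i)).
  by apply: measurable_funB; apply: (measurableT_comp (measurable_tnth i)).
by apply/funext => p /=; rewrite tnth_tsub.
Qed.

Lemma measurable_enorm_tsubl x :
  measurable_fun setT (fun y => enorm (tsub x y)).
Proof.
exact: (measurableT_comp measurable_enorm_tsub (pair1_measurable x)).
Qed.

Lemma measurable_enorm_tsub_powR x (c : R) :
  measurable_fun setT (fun y => enorm (tsub x y) `^ c).
Proof.
exact: (measurableT_comp (@measurable_powR R c) (measurable_enorm_tsubl x)).
Qed.

Lemma measurable_ball_tsub x r : measurable [set y | enorm (tsub x y) < r].
Proof.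
rewrite -[X in measurable X]setTI.
exact: (measurable_fun_ltr (measurable_enorm_tsubl x) (measurable_cst r)).
Qed.

Lemma measurable_box (A : 'I_d -> set R) : (forall i, measurable (A i)) ->
  measurable [set t : d.-tuple R | forall i, A i (tnth t i)].
Proof.
move=> mA; rewrite (_ : [set t | _] = \bigcap_(i in [set: 'I_d])
    ((fun t : d.-tuple R => tnth t i) @^-1` A i)).
  apply: fin_bigcap_measurable => // i _.
  by rewrite -[X in measurable X]setTI; exact: measurable_tnth.
by apply/seteqP; split=> t /= h i; [move=> _|]; exact: h.
Qed.

(** The ball lies in the cube of side [2 r] with the same centre; only the order [r ^ d] matters
    later. *)
Lemma lebesgue_tuple_ball_le x r : 0 <= r ->
  (lebesgue_tuple R d [set y | (enorm (tsub x y) < r)%R] <=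
   ((2 * r) ^+ d)%:E)%E.
Proof.
move=> r0.
pose I i : set R := `[tnth x i - r, tnth x i + r]%classic.
have mI i : measurable (I i) by exact: measurable_itv.
have -> : ((2 * r) ^+ d)%:E =
    (\prod_(i < d) lebesgue_measure (I i))%E.
  rewrite -[d in LHS]card_ord -prodr_const -prodEFin; apply: eq_bigr => i _.
  rewrite lebesgue_measure_itv/= lte_fin.
  by case: ifPn => h; congr EFin; lra.
rewrite -lebesgue_tuple_box//; apply: le_measure; rewrite ?inE.
- exact: measurable_ball_tsub.
- exact: measurable_box.
- move=> y /= xy i.
  have := norm_tnth_le_enorm (tsub x y) i.
  rewrite tnth_tsub /I /= in_itv /= ler_norml; lra.
Qed.

Lemma lebesgue_tuple_cube (a b : R) : a <= b ->
  lebesgue_tuple R d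
    [set t : d.-tuple R | forall i, `[a, b[%classic (tnth t i)] =
  ((b - a) ^+ d)%:E.
Proof.
move=> ab; rewrite (@lebesgue_tuple_box _ _ (fun=> `[a, b[%classic))//.
rewrite -[d in RHS]card_ord -prodr_const -prodEFin; apply: eq_bigr => i _.
rewrite lebesgue_measure_itv/= lte_fin; case: ifPn => h; congr EFin; lra.
Qed.

End enorm_theory.

(** * Integrals of powers of the distance *)

Lemma dyadic_shell (R : realType) (r t : R) : 0 < t < r ->
  exists k, r * 2^-1 ^+ k.+1 <= t < r * 2^-1 ^+ k.
Proof.
move=> /andP[t0 tr]; have r0 : 0 < r by exact: lt_trans tr.
have ex : exists k, r * 2^-1 ^+ k.+1 <= t.
  have [k kP] : exists k : nat, r / t < k%:R.
    exists (Num.truncn (r / t)).+1; exact: truncnS_gt.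
  exists k; rewrite exprVn ler_pdivrMr ?exprn_gt0// mulrC -ler_pdivrMr//.
  rewrite (le_trans (ltW kP))// -natrX ler_nat ltnW// (ltn_trans (ltnSn k))//.
  exact: ltn_expl.
(* The least such [k] works: minimality gives the upper bound, which for [k = 0] is just [t < r]. *)
case: (ex_minnP ex) => -[|k] kt kmin; first by exists 0; rewrite kt expr0 mulr1.
exists k.+1; rewrite kt ltNge; apply/negP => /kmin.
by rewrite ltnn.
Qed.

(** [f] is dominated by the sum of [a k] times the indicator of the whole ball of radius
    [r / 2 ^ k]. Using balls instead of shells costs a constant and requires only an upper bound on
    their volume. The shells miss the centre, hence the separate condition there. *)
Lemma integral_dyadic_le (R : realType) (d : nat) (z : d.-tuple R) (r : R)
    (f : d.-tuple R -> R) (a : nat -> R) : 0 < r ->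
  measurable_fun setT f -> (forall y, 0 <= f y) -> (forall k, 0 <= a k) ->
  (forall y k, r * 2^-1 ^+ k.+1 <= enorm (tsub z y) < r * 2^-1 ^+ k ->
    f y <= a k) ->
  (forall y, enorm (tsub z y) = 0 \/ r <= enorm (tsub z y) -> f y = 0) ->
  (\int[lebesgue_tuple R d]_y (f y)%:E <=
   \sum_(0 <= k <oo) (a k * (2 * (r * 2^-1 ^+ k)) ^+ d)%:E)%E.
Proof.
move=> r0 mf f0 a0 fa fz.
have rk0 k : 0 <= r * 2^-1 ^+ k by rewrite mulr_ge0 ?exprn_ge0 ?ltW.
pose B k := [set y | enorm (tsub z y) < r * 2^-1 ^+ k].
have mB k : measurable (B k) by exact: measurable_ball_tsub.
pose g k (y : d.-tuple R) := (a k * \1_(B k) y)%:E.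
have g0 k y : (0 <= g k y)%E by rewrite lee_fin mulr_ge0.
have mg k : measurable_fun setT (g k).
  by apply/measurable_EFinP; exact: measurable_funM.
apply: (@le_trans _ _ (\int[lebesgue_tuple R d]_y \sum_(0 <= k <oo) g k y)%E).
  apply: ge0_le_integral => //.
  - by move=> y _; rewrite lee_fin.
  - exact/measurable_EFinP.
  - exact: ge0_emeasurable_sum.
  move=> y _; have sum0 : (0 <= \sum_(0 <= k <oo) g k y)%E.
    by apply: nneseries_ge0.
  have [y0|y0] := eqVneq (enorm (tsub z y)) 0; first by rewrite fz//; left.
  have [ry|yr] := leP r (enorm (tsub z y)); first by rewrite fz//; right.
  have [|k yk] := @dyadic_shell R r (enorm (tsub z y)).
    by rewrite yr andbT lt_neqAle eq_sym y0 enorm_ge0.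
  apply: (@le_trans _ _ (g k y)).
    rewrite lee_fin indicE mem_set ?mulr1; first exact: fa.
    by case/andP: yk.
  apply: le_trans (nneseries_lim_ge k.+1 _); last by [].
  by rewrite big_nat_recr//= leeDr// sume_ge0.
rewrite integral_nneseries//; apply: lee_nneseries => [k _ _|k _].
  exact: integral_ge0.
rewrite /g; under eq_integral do rewrite EFinM.
rewrite ge0_integralZl_EFin//; last exact/measurable_EFinP.
rewrite integral_indic// setIT EFinM; apply: lee_wpmul2l.
  by rewrite lee_fin.
exact: (lebesgue_tuple_ball_le z (rk0 k)).
Qed.

(** Strict positivity of [x] matters, because a nonzero power of 0 is 0 even for a negative
    exponent. *)
Lemma ler_powRN (R : realType) (a x y : R) : 0 <= a -> 0 < x -> x <= y ->
  y `^ (- a) <= x `^ (- a).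
Proof.
move=> a0 x0 xy; have y0 : 0 < y by exact: lt_le_trans xy.
by rewrite !powRN lef_pV2 ?posrE ?powR_gt0// ge0_ler_powR// nnegrE ltW.
Qed.

(** The dyadic terms form a geometric series whose ratio is [2 ^ (p - d)], less than 1 because
    [p < d]. Scaling makes the constant independent of both centre and radius. *)
Lemma integral_ball_powR_le (R : realType) (d : nat) (p : R) : 0 < p < d%:R ->
  exists2 C, 0 <= C & forall (z : d.-tuple R) r, 0 < r ->
  (\int[lebesgue_tuple R d]_y (enorm (tsub z y) `^ (- p) *
      \1_[set y | (enorm (tsub z y) < r)%R] y)%:E
    <= (C * (r ^+ d * r `^ (- p)))%:E)%E.
Proof.
move=> /andP[p0 pd].
set h : R := 2^-1; have h0 : 0 < h by rewrite invr_gt0.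
pose q := h `^ (- p) * h ^+ d.
have q0 : 0 <= q by rewrite mulr_ge0 ?powR_ge0 ?exprn_ge0 ?ltW.
have q1 : q < 1.
  rewrite /q -powR_mulrn ?(ltW h0)// -powRD; last first.
    by rewrite (gt_eqF h0) implybT.
  rewrite -[ltRHS](powRr0 h) /powR gt_eqF// ltr_expR ltr_nM2r; first by lra.
  by rewrite ln_lt0// h0 invf_lt1// ltr1n.
exists (h `^ (- p) * 2 ^+ d / (1 - q)) => [|z r r0].
  by rewrite divr_ge0 ?subr_ge0 ?(ltW q1)// mulr_ge0 ?powR_ge0 ?exprn_ge0.
apply: le_trans.
  apply: (@integral_dyadic_le R d z r _
    (fun k => (r * h ^+ k.+1) `^ (- p))) => //.
  - apply: measurable_funM; last first.
      by apply: measurable_indic; exact: (measurable_ball_tsub z r).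
    exact: measurable_enorm_tsub_powR.
  - by move=> y; rewrite mulr_ge0 ?powR_ge0.
  - by move=> k; exact: powR_ge0.
  - move=> y k /andP[yk _].
    rewrite (@le_trans _ _ (enorm (tsub z y) `^ (- p)))//.
      by rewrite ler_piMr ?powR_ge0// indicE lern1 leq_b1.
    by rewrite ler_powRN// ?ltW// mulr_gt0// exprn_gt0.
  - move=> y [->|ry]; first by rewrite powR0 ?mul0r// oppr_eq0 gt_eqF.
    by rewrite indicE memNset ?mulr0//= ltNge ry.
rewrite -/h.
have c0 : 0 <= h `^ (- p) * 2 ^+ d * (r ^+ d * r `^ (- p)).
  by rewrite !(mulr_ge0, powR_ge0, exprn_ge0) ?ltW.
have q01 : 0 <= q < 1 by rewrite q0.
rewrite mulrAC; apply: le_trans (nneseries_geometric_le c0 q01).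
rewrite le_eqVlt; apply/orP; left; apply/eqP; apply: eq_eseriesr => k _.
have hk : (h ^+ k) `^ (- p) = (h `^ (- p)) ^+ k.
  by rewrite -(powR_mulrn k (ltW h0)) -(powR_mulrn k (powR_ge0 h (- p))) powRAC.
congr EFin; rewrite exprS !powRM ?mulr_ge0 ?exprn_ge0 ?(ltW h0) ?(ltW r0)// hk.
rewrite /q !exprMn -exprM [(k * d)%N]mulnC exprM.
ring.
Qed.

(** What is left of the integrand as a function of [y], on the half [|y| <= |x|], once the
    logarithmic factor at [y] has been bounded by the one at [x]. *)
Definition lower_kernel (R : realType) (d : nat) (a b : R)
    (x y : d.-tuple R) : R :=
  enorm y `^ (- a) * enorm (tsub x y) `^ (- b) *
  \1_[set z : d.-tuple R | enorm z <= enorm x] y.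

Lemma lower_kernel_ge0 (R : realType) (d : nat) (a b : R) (x y : d.-tuple R) :
  0 <= lower_kernel a b x y.
Proof. by rewrite !mulr_ge0 ?powR_ge0. Qed.

Lemma measurable_lower_kernel (R : realType) (d : nat) (a b : R) :
  measurable_fun setT
    (fun q : d.-tuple R * d.-tuple R => lower_kernel a b q.1 q.2).
Proof.
apply: measurable_funM.
  apply: measurable_funM.
    exact: (measurableT_comp (measurable_enorm_powR _) measurable_snd).
  exact: (measurableT_comp (@measurable_powR R (- b))
    (@measurable_enorm_tsub R d)).
rewrite (_ : (fun _ => _) =
    \1_[set q : d.-tuple R * d.-tuple R | enorm q.2 <= enorm q.1]).
  apply: measurable_indic; rewrite -[X in measurable X]setTI.
  exact: (measurable_fun_ler
    (measurableT_comp (@measurable_enorm R d) measurable_snd)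
    (measurableT_comp (@measurable_enorm R d) measurable_fst)).
apply/funext => q; rewrite !indicE; congr ((_ : bool)%:R).
Qed.

Lemma measurable_lower_kernelr (R : realType) (d : nat) (a b : R)
    (x : d.-tuple R) : measurable_fun setT (lower_kernel a b x).
Proof.
exact: (measurableT_comp (@measurable_lower_kernel R d a b)
  (pair1_measurable x)).
Qed.

(** Split at [|y| = |x| / 2]. Below it, [|x - y| >= |x| / 2], so the second factor is bounded by
    [(|x| / 2) ^ (-b)]; above it, the first is bounded by [(|x| / 2) ^ (-a)]. The other factor is
    then integrated over a ball of radius comparable to [|x|]. *)
Lemma integral_lower_kernel_le (R : realType) (d : nat) (a b : R) :
  0 < a < d%:R -> 0 < b < d%:R ->
  exists2 C, 0 <= C & forall x : d.-tuple R, 0 < enorm x ->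
  (\int[lebesgue_tuple R d]_y (lower_kernel a b x y)%:E
    <= (C * (enorm x ^+ d * enorm x `^ (- a) * enorm x `^ (- b)))%:E)%E.
Proof.
move=> a0 b0; have [Ca Ca0 CaP] := @integral_ball_powR_le R d a a0.
have [Cb Cb0 CbP] := @integral_ball_powR_le R d b b0.
case/andP: a0 => a0 _; case/andP: b0 => b0 _.
exists (2^-1 `^ (- b) * (Ca * (2 ^+ d * 2 `^ (- a))) +
        2^-1 `^ (- a) * (Cb * (3 ^+ d * 3 `^ (- b)))) => [|x].
  by rewrite ?(addr_ge0, mulr_ge0, powR_ge0, exprn_ge0).
set r := enorm x => r0.
pose z : d.-tuple R := [tuple 0 | _ < d].
pose u s c (z y : d.-tuple R) :=
  enorm (tsub z y) `^ (- c) * \1_[set y | (enorm (tsub z y) < s)%R] y.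
have mu s c z' : measurable_fun setT (u s c z').
  apply: measurable_funM.
    exact: measurable_enorm_tsub_powR.
  by apply: measurable_indic; exact: (measurable_ball_tsub z' s).
have u0 s c z' y : 0 <= u s c z' y by rewrite mulr_ge0 ?powR_ge0.
pose A : R := (2^-1 * r) `^ (- b); pose B : R := (2^-1 * r) `^ (- a).
have A0 : 0 <= A by exact: powR_ge0.
have B0 : 0 <= B by exact: powR_ge0.
(* The balls are open, so their radii [2 r] and [3 r] are chosen strictly above the bounds [r / 2]
   on [|y|] and [2 r] on [|x - y|]. *)
apply: (@le_trans _ _ (\int[lebesgue_tuple R d]_y
    ((A * u (2 * r) a z y)%:E + (B * u (3 * r) b x y)%:E))%E).
  apply: ge0_le_integral => //.
  - by move=> y _; rewrite lee_fin lower_kernel_ge0.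
  - by apply/measurable_EFinP; exact: measurable_lower_kernelr.
  - by apply: emeasurable_funD; apply/measurable_EFinP; apply: measurable_funM.
  move=> y _; rewrite -EFinD lee_fin.
  have Au0 : 0 <= A * u (2 * r) a z y by rewrite mulr_ge0.
  have Bu0 : 0 <= B * u (3 * r) b x y by rewrite mulr_ge0.
  rewrite /lower_kernel indicE; case: (boolP (y \in _)); last first.
    by rewrite mulr0 addr_ge0.
  rewrite inE mulr1 /= => yr.
  have xy2 : enorm (tsub x y) <= 2 * r by exact: enorm_tsub_le.
  have [yr2|yr2] := leP (enorm y) (2^-1 * r).
    rewrite -[leLHS]addr0 lerD// /u enorm_tsub0 indicE mem_set/=; last first.
      by rewrite enorm_tsub0; lra.
    rewrite mulr1 mulrC ler_wpM2r ?powR_ge0//.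
    apply: ler_powRN; [exact: ltW|by rewrite mulr_gt0|].
    by apply: enorm_tsub_ge => //; rewrite mulrA divff// mul1r.
  rewrite -[leLHS]add0r lerD// /u indicE mem_set/=; last by lra.
  rewrite mulr1 ler_wpM2r ?powR_ge0// ler_powRN ?(ltW a0) ?(ltW yr2)//.
  by rewrite mulr_gt0.
rewrite ge0_integralD//; last 4 first.
  - by move=> y _; rewrite lee_fin mulr_ge0.
  - by apply/measurable_EFinP; apply: measurable_funM.
  - by move=> y _; rewrite lee_fin mulr_ge0.
  - by apply/measurable_EFinP; apply: measurable_funM.
under eq_integral do rewrite EFinM.
under [X in (_ + X)%E]eq_integral do rewrite EFinM.
rewrite !ge0_integralZl_EFin//; last 4 first.
  - by move=> y _; rewrite lee_fin.
  - exact/measurable_EFinP.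
  - by move=> y _; rewrite lee_fin.
  - exact/measurable_EFinP.
have r2 : 0 < 2 * r by rewrite mulr_gt0.
have r3 : 0 < 3 * r by rewrite mulr_gt0.
apply: (le_trans
  (leeD (lee_wpmul2l _ (CaP z _ r2)) (lee_wpmul2l _ (CbP x _ r3)))).
- by rewrite lee_fin.
- by rewrite lee_fin.
rewrite -!EFinM -EFinD lee_fin /A /B !powRM ?(ltW r0)// !exprMn.
rewrite le_eqVlt; apply/orP; left; apply/eqP; ring.
Qed.

Lemma ln_half_le (R : realType) (n : nat) (t : R) : 0 < t <= 2^-1 ^+ n ->
  n%:R * ln 2 <= - ln t.
Proof.
move=> /andP[t0 tn]; rewrite lerNr -mulrN -lnV ?posrE//.
rewrite mulr_natl -lnXn ?invr_gt0// ler_ln// posrE exprn_gt0 ?invr_gt0//.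
Qed.

Lemma ln_half_ge (R : realType) (n : nat) (t : R) : 2^-1 ^+ n <= t ->
  - ln t <= n%:R * ln 2.
Proof.
move=> tn; have h0 : 0 < 2^-1 ^+ n :> R by rewrite exprn_gt0 ?invr_gt0.
rewrite lerNl -mulrN -lnV ?posrE// mulr_natl -lnXn ?invr_gt0// ler_ln// posrE.
exact: lt_le_trans tn.
Qed.

(** * Power weights with a logarithmic factor *)

(** A family containing both the potential ([c = alpha], [p = gamma]) and the function left after
    the inner integration ([c = d], [p = 2 gamma]). The cutoff is part of it, and multiplying by a
    power of [|x|] only shifts [c]. *)
Definition log_weight (R : realType) (d : nat) (c p : R) (x : d.-tuple R) : R :=
  enorm x `^ (- c) * (- ln (enorm x)) `^ (- p) *
  \1_[set y : d.-tuple R | enorm y < 2^-1] x.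

Lemma log_potentialE (R : realType) (d : nat) (a g : R) :
  @log_potential R d a g = log_weight a g.
Proof. by rewrite /log_potential div1r. Qed.

Section log_weight_theory.
Context (R : realType) (d : nat).
Implicit Types (c p : R) (x : d.-tuple R).

Lemma log_weight_ge0 c p x : 0 <= log_weight c p x.
Proof. by rewrite !mulr_ge0 ?powR_ge0. Qed.

Lemma measurable_log_weight c p : measurable_fun setT (@log_weight R d c p).
Proof.
apply: measurable_funM; last first.
  by apply: measurable_indic; exact: measurable_enorm_lt.
apply: measurable_funM; first exact: measurable_enorm_powR.
exact: measurable_ln_enorm_powR.
Qed.

Lemma log_weight_in c p x : enorm x < 2^-1 ->
  log_weight c p x = enorm x `^ (- c) * (- ln (enorm x)) `^ (- p).
Proof. by move=> x2; rewrite /log_weight indicE mem_set// mulr1. Qed.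

Lemma log_weight_out c p x : 2^-1 <= enorm x -> log_weight c p x = 0.
Proof.
move=> x2; rewrite /log_weight indicE memNset ?mulr0//=.
by apply/negP; rewrite -leNgt.
Qed.

Lemma log_weight_center c p x : c != 0 -> enorm x = 0 -> log_weight c p x = 0.
Proof. by move=> c0 x0; rewrite /log_weight x0 powR0 ?oppr_eq0// !mul0r. Qed.

Lemma log_weight_powR c p e x : 0 < enorm x ->
  log_weight c p x * enorm x `^ e = log_weight (c - e) p x.
Proof.
move=> x0; rewrite /log_weight opprB addrC powRD; last first.
  by rewrite (gt_eqF x0) implybT.
by rewrite [LHS]mulrAC; congr (_ * _); rewrite mulrAC.
Qed.

(** Inside the cutoff [-log|y| >= -log|x| > 0], so for [p >= 0] the logarithmic factor at [y] is at
    most the one at [x]. At [y = 0] the left side vanishes by the convention for powers of 0. *)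
Lemma log_weight_mul_le c p x (y : d.-tuple R) : c != 0 -> 0 <= p ->
  enorm y <= enorm x ->
  log_weight c p x * log_weight c p y <=
  log_weight c (2 * p) x * enorm y `^ (- c).
Proof.
move=> c0 p0 yx.
have [y0|y0] := eqVneq (enorm y) 0.
  rewrite (log_weight_center _ _ y0)// mulr0.
  by rewrite mulr_ge0 ?log_weight_ge0 ?powR_ge0.
have yp : 0 < enorm y by rewrite lt_neqAle eq_sym y0 enorm_ge0.
have xp : 0 < enorm x by exact: lt_le_trans yx.
have [x2|x2] := ltP (enorm x) 2^-1; last first.
  by rewrite !(log_weight_out _ _ x2) !mul0r.
have y2 : enorm y < 2^-1 by exact: le_lt_trans x2.
have Lx : 0 < - ln (enorm x).
  by rewrite oppr_gt0 ln_lt0// xp (lt_trans x2)// invf_lt1// ltr1n.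
have Lxy : - ln (enorm x) <= - ln (enorm y) by rewrite lerN2 ler_ln.
have := ler_powRN p0 Lx Lxy.
rewrite !log_weight_in// mulr_natl mulr2n opprD powRD; last first.
  by rewrite (gt_eqF Lx) implybT.
have := powR_ge0 (enorm x) (- c); have := powR_ge0 (enorm y) (- c).
have := powR_ge0 (- ln (enorm x)) (- p).
move: (enorm x `^ _) (enorm y `^ _) (_ `^ (- p)) (_ `^ (- p)).
move=> A B X Y X0 B0 A0 YX.
by rewrite [leLHS]mulrACA [leRHS]mulrAC !ler_wpM2l ?mulr_ge0.
Qed.

End log_weight_theory.

Lemma integral_log_weight_lty (R : realType) (d : nat) (p : R) : (0 < d)%N ->
  1 < p ->
  (\int[lebesgue_tuple R d]_x (log_weight d%:R p x)%:E < +oo)%E.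
Proof.
move=> d0 p1; have ln20 : 0 < ln 2 :> R by rewrite ln_gt0// ltr1n.
set h : R := 2^-1; have h0 : 0 < h by rewrite invr_gt0.
have hk k : 0 < h ^+ k by rewrite exprn_gt0.
(* On shell [k] one has [h ^ (k + 2) <= |x| < h ^ (k + 1)]: the lower bound controls the power, the
   upper one gives [-log|x| >= (k + 1) ln 2]. *)
pose a k := (h ^+ k.+2) `^ (- d%:R) * (k.+1%:R * ln 2) `^ (- p).
have dR0 : 0 < d%:R :> R by rewrite ltr0n.
apply: le_lt_trans.
  apply: (@integral_dyadic_le R d [tuple 0 | _ < d] h _ a) => //.
  - exact: measurable_log_weight.
  - by move=> x; exact: log_weight_ge0.
  - by move=> k; rewrite /a mulr_ge0 ?powR_ge0.
  - move=> x k; rewrite enorm_tsub0 -!exprS => /andP[kx xk].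
    have x0 : 0 < enorm x by exact: lt_le_trans kx.
    apply: (@le_trans _ _ (enorm x `^ (- d%:R) * (- ln (enorm x)) `^ (- p))).
      by rewrite /log_weight ler_piMr ?mulr_ge0 ?powR_ge0// indicE lern1 leq_b1.
    rewrite ler_pM ?powR_ge0//; first exact: (ler_powRN (ltW dR0) (hk _) kx).
    apply: ler_powRN; first by lra.
      by rewrite mulr_gt0.
    by apply: ln_half_le; rewrite x0 ltW.
  - move=> x; rewrite enorm_tsub0 => -[x0|hx].
      by rewrite log_weight_center// gt_eqF.
    exact: log_weight_out.
pose c : R := 4 ^+ d * ln 2 `^ (- p).
have -> : (\sum_(0 <= k <oo) (a k * (2 * (h * h ^+ k)) ^+ d)%:E =
    \sum_(0 <= k <oo) (c%:E * (k.+1%:R `^ (- p))%:E))%E.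
  apply: eq_eseriesr => k _; rewrite -EFinM; congr EFin.
  rewrite /a /c powRM ?ler0n ?(ltW ln20)// powR_invn ?(ltW (hk _))//.
  rewrite [2 * (h * _)]mulrA [2 * h]divff// mul1r.
  (* The power [|x| ^ (-d)] exactly offsets the volume, leaving a factor independent of [k]. *)
  have -> : 4 ^+ d = (h ^+ k.+2) ^- d * (h ^+ k) ^+ d.
    rewrite -exprVn -exprMn; congr (_ ^+ _).
    rewrite -(addn2 k) exprD invfM mulrAC mulVf ?gt_eqF// mul1r /h exprVn invrK.
    by ring.
  by ring.
rewrite nneseriesZl; last by move=> k _; rewrite lee_fin powR_ge0.
by rewrite lte_mul_pinfty ?lee_fin ?mulr_ge0 ?powR_ge0 ?exprn_ge0//
  nneseries_powR_lty.
Qed.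

(** * Measurability of the kernel, and Borel implies Lebesgue measurable *)

Lemma measurable_rollnik_kernel (R : realType) (d : nat) (b : R)
    (V : d.-tuple R -> R) : measurable_fun setT V ->
  measurable_fun setT (fun q : d.-tuple R * d.-tuple R =>
    `|V q.1| * `|V q.2| / enorm (tsub q.1 q.2) `^ b).
Proof.
move=> mV.
under eq_fun do rewrite -powRN.
apply: measurable_funM.
  apply: measurable_funM; apply: measurableT_comp => //.
    exact: (measurableT_comp mV measurable_fst).
  exact: (measurableT_comp mV measurable_snd).
exact: (measurableT_comp (@measurable_powR R (- b))
    (@measurable_enorm_tsub R d)).
Qed.

Lemma lebesgue_measurable_funW (R : realType) (d : nat) (V : d.-tuple R -> R) :
  measurable_fun setT V -> lebesgue_measurable_fun V.
Proof.
move=> mV B mB; have := mV measurableT B mB; rewrite setTI => mVB.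
exists (V @^-1` B) => //; exists set0; last by rewrite setU0.
exact: negligible_set0.
Qed.

(** * Finiteness for gamma > 1/2 *)

Section symmetrization.
Context dd (T : measurableType dd) (R : realType)
  (mu : {sigma_finite_measure set T -> \bar R}).
Variables K H : T * T -> R.
Hypotheses (mK : measurable_fun setT K) (mH : measurable_fun setT H).
Hypotheses (K0 : forall q, 0 <= K q) (H0 : forall q, 0 <= H q).
Hypothesis KH : forall x y, K (x, y) <= H (x, y) + H (y, x).
Local Open Scope ereal_scope.

(** Integrate the hypothesis [KH]; Tonelli shows that the two terms on its right have the same
    double integral. *)
Lemma integral2_symmetrize_lty : \int[mu]_x \int[mu]_y (H (x, y))%:E < +oo ->
  \int[mu]_x \int[mu]_y (K (x, y))%:E < +oo.
Proof.
move=> Hoo; pose H' q := H (q.2, q.1).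
have mH' : measurable_fun setT H'.
  exact: (measurableT_comp mH
    (measurable_fun_pair measurable_snd measurable_fst)).
have mEK : measurable_fun setT (EFin \o K) by exact/measurable_EFinP.
have mEH : measurable_fun setT (EFin \o H) by exact/measurable_EFinP.
have mEH' : measurable_fun setT (EFin \o H') by exact/measurable_EFinP.
have EK0 q : 0 <= (EFin \o K) q by rewrite lee_fin.
have EH0 q : 0 <= (EFin \o H) q by rewrite lee_fin.
have EH'0 q : 0 <= (EFin \o H') q by rewrite lee_fin; exact: H0.
have mEKx x : measurable_fun setT (fun y => (K (x, y))%:E).
  exact: (measurable_fun_pair2 x mEK).
have mEHx x : measurable_fun setT (fun y => (H (x, y))%:E).
  exact: (measurable_fun_pair2 x mEH).
have mEH'x x : measurable_fun setT (fun y => (H (y, x))%:E).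
  exact: (measurable_fun_pair2 x mEH').
have mFK : measurable_fun setT (fun x => \int[mu]_y (K (x, y))%:E).
  exact: (measurable_fun_fubini_tonelli_F _ mEK EK0).
have mFH : measurable_fun setT (fun x => \int[mu]_y (H (x, y))%:E).
  exact: (measurable_fun_fubini_tonelli_F _ mEH EH0).
have mFH' : measurable_fun setT (fun x => \int[mu]_y (H (y, x))%:E).
  exact: (measurable_fun_fubini_tonelli_F _ mEH' EH'0).
have F0 (G : T * T -> R) x : (forall q, (0 <= G q)%R) ->
    0 <= \int[mu]_y (G (x, y))%:E.
  by move=> G0; apply: integral_ge0 => y _; rewrite lee_fin.
apply: (@le_lt_trans _ _ (\int[mu]_x
    (\int[mu]_y (H (x, y))%:E + \int[mu]_y (H (y, x))%:E))).
  apply: ge0_le_integral => //.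
  - by move=> x _; exact: F0.
  - exact: emeasurable_funD.
  move=> x _; rewrite -ge0_integralD//; last 2 first.
    by move=> y _; rewrite lee_fin.
    by move=> y _; rewrite lee_fin.
  apply: ge0_le_integral => //.
  - by move=> y _; rewrite lee_fin.
  - exact: emeasurable_funD.
  - by move=> y _; rewrite -EFinD lee_fin.
rewrite ge0_integralD//; last 2 first.
  by move=> x _; exact: F0.
  by move=> x _; exact: (F0 H').
rewrite [X in _ + X](_ : _ = \int[mu]_x \int[mu]_y (H (x, y))%:E).
  by rewrite lte_add_pinfty.
exact: (fubini_tonelli _ mEH' EH'0).
Qed.

End symmetrization.

Section rollnik_upper.
Context (R : realType) (d : nat).
Variables (a g : R).
Hypotheses (a0 : 0 < a) (ad : a < d%:R) (da : d%:R < 2 * a).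
Let b : R := 2 * (d%:R - a).
Let H (q : d.-tuple R * d.-tuple R) : R :=
  log_weight a (2 * g) q.1 * lower_kernel a b q.1 q.2.
Let K (q : d.-tuple R * d.-tuple R) : R :=
  `|log_weight a g q.1| * `|log_weight a g q.2| / enorm (tsub q.1 q.2) `^ b.

Let H_ge0 q : 0 <= H q.
Proof. by rewrite mulr_ge0 ?log_weight_ge0 ?lower_kernel_ge0. Qed.

Let mH : measurable_fun setT H.
Proof.
apply: measurable_funM; last exact: measurable_lower_kernel.
exact: (measurableT_comp (measurable_log_weight _ _) measurable_fst).
Qed.

Let K_le x y : 0 <= g -> enorm y <= enorm x -> K (x, y) <= H (x, y).
Proof.
move=> g0 yx; rewrite /K /H /lower_kernel/= !ger0_norm ?log_weight_ge0//.
rewrite -powRN indicE mem_set// mulr1 mulrA ler_wpM2r ?powR_ge0//.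
by apply: log_weight_mul_le => //; rewrite gt_eqF.
Qed.

Let integral_H_le : exists2 C, 0 <= C & forall x,
  (\int[lebesgue_tuple R d]_y (H (x, y))%:E <=
   C%:E * (log_weight d%:R (2 * g) x)%:E)%E.
Proof.
have ab0 : 0 < a < d%:R by rewrite a0.
(* Positivity of [b] is [a < d], and [b < d] is [d < 2 a]. *)
have b0 : 0 < b < d%:R.
  by apply/andP; split; have := ad; have := da; rewrite /b; lra.
have [C C0 CP] := integral_lower_kernel_le ab0 b0.
exists C => // x; rewrite /H /=; under eq_integral do rewrite EFinM.
rewrite ge0_integralZl_EFin//; last 3 first.
  by move=> y _; rewrite lee_fin lower_kernel_ge0.
  by apply/measurable_EFinP; exact: measurable_lower_kernelr.
  exact: log_weight_ge0.
have [x0|x0] := eqVneq (enorm x) 0.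
  rewrite log_weight_center// ?gt_eqF// mul0e mule_ge0// lee_fin.
  exact: log_weight_ge0.
have xp : 0 < enorm x by rewrite lt_neqAle eq_sym x0 enorm_ge0.
apply: (le_trans (lee_wpmul2l _ (CP x xp))).
  by rewrite lee_fin log_weight_ge0.
rewrite -!EFinM lee_fin mulrCA ler_wpM2l// -powR_mulrn ?enorm_ge0// mulrA mulrA.
(* The exponents add up to [a - d + a + b = d] by the choice of [b]. *)
rewrite !log_weight_powR// (_ : a - d%:R - - a - - b = d%:R)//.
by rewrite /b; ring.
Qed.

Lemma rollnik_sqnorm_lty : 1 / 2 < g ->
  (rollnik_sqnorm a (@log_potential R d a g) < +oo)%E.
Proof.
move=> g2; have d0 : (0 < d)%N by rewrite -(ltr0n R) (lt_trans a0).
rewrite log_potentialE; apply: (@integral2_symmetrize_lty _ _ _ _ K H) => //.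
- by apply: measurable_rollnik_kernel; exact: measurable_log_weight.
- by move=> q; rewrite !mulr_ge0 ?invr_ge0 ?powR_ge0.
- move=> x y; have g0 : 0 <= g by lra.
  have [yx|xy] := leP (enorm y) (enorm x).
    by rewrite (le_trans (K_le g0 yx))// lerDl.
  rewrite (_ : K (x, y) = K (y, x)).
    by rewrite (le_trans (K_le g0 (ltW xy)))// lerDr.
  by rewrite /K /= enorm_tsubC [in LHS](mulrC `|_|).
have [C C0 CP] := integral_H_le.
apply: (@le_lt_trans _ _ (\int[lebesgue_tuple R d]_x
    (C%:E * (log_weight d%:R (2 * g) x)%:E))%E); last first.
  rewrite ge0_integralZl_EFin//; last 2 first.
    by move=> x _; rewrite lee_fin log_weight_ge0.
    by apply/measurable_EFinP; exact: measurable_log_weight.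
  by rewrite lte_mul_pinfty// integral_log_weight_lty//; lra.
apply: ge0_le_integral => //.
- by move=> x _; apply: integral_ge0 => y _; rewrite lee_fin.
- apply: (@measurable_fun_fubini_tonelli_F _ _ _ _ R _ (EFin \o H)).
    exact/measurable_EFinP.
  by move=> q; rewrite lee_fin.
- apply: measurable_funeM; apply/measurable_EFinP; exact: measurable_log_weight.
Qed.

End rollnik_upper.

(** * Divergence for gamma <= 1/2 *)

Section rollnik_lower.
Context (R : realType) (d : nat).
Hypothesis d_gt0 : (0 < d)%N.

Let h : R := 2^-1.
(** Starting at 1/4 keeps every box below inside the cutoff [|x| < 1/2]. The factor [rho] turns
    bounds on all coordinates into bounds on the Euclidean norm without a dimensional constant. *)
Let s k : R := h ^+ k.+2.
Let rho : R := (Num.sqrt d%:R)^-1.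

Let h_gt0 : 0 < h. Proof. by rewrite invr_gt0. Qed.
Let h_lt1 : h < 1. Proof. by rewrite invf_lt1// ltr1n. Qed.
Let s_gt0 k : 0 < s k. Proof. by rewrite exprn_gt0. Qed.
Let sS k : s k.+1 = h * s k. Proof. by rewrite /s exprS. Qed.
Let s_le k j : (k <= j)%N -> s j <= s k.
Proof. by move=> kj; rewrite ler_wiXn2l// ltW. Qed.
Let s_lt_half k : s k < h.
Proof. by rewrite /s exprS gtr_pMr// exprn_ilt1// ltW. Qed.
Let ln2_gt0 : 0 < ln 2 :> R. Proof. by rewrite ln_gt0// ltr1n. Qed.
Let sqrtd_gt0 : 0 < Num.sqrt d%:R :> R. Proof. by rewrite sqrtr_gt0 ltr0n. Qed.
Let rho_gt0 : 0 < rho. Proof. by rewrite invr_gt0. Qed.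
Let sqrtd_rho t : Num.sqrt d%:R * (rho * t) = t.
Proof. by rewrite mulrA divff ?mul1r ?gt_eqF. Qed.

(** Cubes on the diagonal of the positive orthant. Being half-open, distinct ones have strictly
    separated coordinates, which gives both disjointness and distance from the diagonal [x = y]. *)
Let B k := [set t : d.-tuple R |
  forall i, `[rho * s k.+1, rho * s k[%classic (tnth t i)].

Let mB k : measurable (B k).
Proof.
by apply: (@measurable_box R d (fun=> `[rho * s k.+1, rho * s k[%classic)).
Qed.

Let lebesgue_B k : lebesgue_tuple R d (B k) = ((rho * s k.+1) ^+ d)%:E.
Proof.
have E : rho * s k - rho * s k.+1 = rho * s k.+1.
  by rewrite sS -mulrBr /h; field.
rewrite /B lebesgue_tuple_cube ?E//.
by rewrite ler_pM2l// s_le.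
Qed.

Let B_enorm k x : B k x -> s k.+1 <= enorm x <= s k.
Proof.
move=> Bx; have rs j : 0 <= rho * s j by rewrite mulr_ge0 ?ltW.
apply/andP; split.
  rewrite -(sqrtd_rho (s k.+1)).
  by apply: enorm_ge => // i; have := Bx i; rewrite /= in_itv/= => /andP[].
rewrite -(sqrtd_rho (s k)).
apply: enorm_le => // i; have := Bx i; rewrite /= in_itv/= => /andP[x1 x2].
by rewrite ger0_norm; [exact: ltW|exact: le_trans x1].
Qed.

Let B_lt k j x y i : (k < j)%N -> B k x -> B j y -> tnth y i < tnth x i.
Proof.
move=> kj /(_ i) + /(_ i); rewrite /= !in_itv/= => /andP[x1 _] /andP[_ y2].
by apply: (lt_le_trans y2); apply: le_trans x1; rewrite ler_pM2l// s_le.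
Qed.

Let B_tsub_gt0 k x y : B k x -> B k.+1 y -> 0 < enorm (tsub x y).
Proof.
move=> Bx By; rewrite lt_neqAle enorm_ge0 andbT eq_sym.
apply/eqP => /enorm_tsub_eq0 xy.
by have := B_lt (Ordinal d_gt0) (ltnSn k) Bx By; rewrite xy ltxx.
Qed.

Let trivIset_B : trivIset setT B.
Proof.
apply/trivIsetP => i j _ _ ij; apply/seteqP; split => // x [Bi Bj].
move: ij; rewrite neq_ltn => /orP[ij|ij].
  by have := B_lt (Ordinal d_gt0) ij Bi Bj; rewrite ltxx.
by have := B_lt (Ordinal d_gt0) ij Bj Bi; rewrite ltxx.
Qed.

Variables (a g : R).
Hypotheses (a0 : 0 < a) (ad : a < d%:R) (g2 : g <= 2^-1).
Let b : R := 2 * (d%:R - a).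
(** Reduces every [g <= 1/2] to the critical case: in [L ^ (-g) = L ^ (1/2 - g) * L ^ (-1/2)] with
    [L = -log|x| >= ln 2], the first factor is at least [c0]. In [m], the bound [L <= (k + 3) ln 2]
    comes from [|x| >= s (k + 1)]. *)
Let c0 : R := ln 2 `^ (2^-1 - g).
Let m k : R := s k `^ (- a) * (c0 * (k.+3%:R * ln 2) `^ (- 2^-1)).

Let log_weight_B_ge k x : B k x -> m k <= log_weight a g x.
Proof.
move=> /B_enorm/andP[x1 x2]; have xp : 0 < enorm x by exact: lt_le_trans x1.
have xh : enorm x < h by exact: le_lt_trans (s_lt_half k).
have Ll : ln 2 <= - ln (enorm x).
  have := @ln_half_le R 1 (enorm x); rewrite mul1r expr1; apply.
  by rewrite xp ltW.
have Lu : - ln (enorm x) <= k.+3%:R * ln 2 by exact: ln_half_ge.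
have L0 : 0 < - ln (enorm x) by exact: lt_le_trans Ll.
rewrite log_weight_in// /m.
have -> : (- ln (enorm x)) `^ (- g) =
    (- ln (enorm x)) `^ (2^-1 - g) * (- ln (enorm x)) `^ (- 2^-1).
  rewrite -powRD; last by rewrite (gt_eqF L0) implybT.
  by congr (_ `^ _); ring.
have h1 : s k `^ (- a) <= enorm x `^ (- a).
  by apply: ler_powRN => //; exact: ltW.
have h2 : c0 <= (- ln (enorm x)) `^ (2^-1 - g).
  by apply: ge0_ler_powR; rewrite ?nnegrE ?subr_ge0// ltW.
have h3 : (k.+3%:R * ln 2) `^ (- 2^-1) <= (- ln (enorm x)) `^ (- 2^-1).
  by apply: ler_powRN.
move: h1 h2 h3; rewrite /c0.
have := powR_ge0 (s k) (- a).
have := powR_ge0 (ln 2 : R) (2^-1 - g).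
have := powR_ge0 (k.+3%:R * ln 2 : R) (- 2^-1).
move: (enorm x `^ _) (s k `^ _) (ln 2 `^ _) ((_ * ln 2) `^ _).
move: (_ `^ (2^-1 - g)) (_ `^ (- 2^-1)) => A1 A2 A3 A4 A5 A6 p6 p5 p4 h1 h2 h3.
by rewrite ler_pM ?mulr_ge0// ler_pM.
Qed.

Let K (q : d.-tuple R * d.-tuple R) : R :=
  `|log_weight a g q.1| * `|log_weight a g q.2| / enorm (tsub q.1 q.2) `^ b.
Let M k : R := m k * m k.+1 * (2 * s k) `^ (- b).

Let K_ge0 q : 0 <= K q.
Proof. by rewrite !mulr_ge0 ?invr_ge0 ?powR_ge0. Qed.

Let mK : measurable_fun setT K.
Proof. by apply: measurable_rollnik_kernel; exact: measurable_log_weight. Qed.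

Let m_ge0 k : 0 <= m k.
Proof. by rewrite !mulr_ge0 ?powR_ge0. Qed.

Let M_ge0 k : 0 <= M k.
Proof. by rewrite !mulr_ge0 ?powR_ge0. Qed.

Let K_B_ge k x y : B k x -> B k.+1 y -> M k <= K (x, y).
Proof.
move=> Bx By; rewrite /K /M /= !ger0_norm ?log_weight_ge0// -powRN.
have [/andP[_ xs] /andP[_ ys]] := (B_enorm Bx, B_enorm By).
have hV := ler_pM (m_ge0 k) (m_ge0 k.+1)
  (log_weight_B_ge Bx) (log_weight_B_ge By).
have b0 : 0 <= b by have := ad; rewrite /b; lra.
have hb : (2 * s k) `^ (- b) <= enorm (tsub x y) `^ (- b).
  apply: ler_powRN => //; first exact: B_tsub_gt0 Bx By.
  by apply: enorm_tsub_le => //; exact: (le_trans ys (s_le (leqnSn k))).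
by apply: ler_pM hb => //; [exact: mulr_ge0|exact: powR_ge0].
Qed.

(** Collects the factors independent of [k]: [h ^ (-a)] comes from [m (k + 1)], and the two [d]-th
    powers from the volumes of [B k] and [B (k + 1)] measured in units of [s k]. *)
Let c : R := c0 ^+ 2 * h `^ (- a) * 2 `^ (- b) * (rho * h) ^+ d *
  (rho * h * h) ^+ d / ln 2.

Let term_ge k :
  c / k.+4%:R <= M k * (rho * s k.+2) ^+ d * (rho * s k.+1) ^+ d.
Proof.
have sk0 := ltW (s_gt0 k).
have L3 : 0 < k.+3%:R * ln 2 :> R by rewrite mulr_gt0.
have L4 : 0 < k.+4%:R * ln 2 :> R by rewrite mulr_gt0.
pose X : R := (k.+3%:R * ln 2) `^ (- 2^-1) * (k.+4%:R * ln 2) `^ (- 2^-1).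
have hr : (k.+4%:R * ln 2 : R)^-1 <= X.
  apply: (@le_trans _ _
    ((k.+4%:R * ln 2) `^ (- 2^-1) * (k.+4%:R * ln 2) `^ (- 2^-1))).
    rewrite -powRD; last by rewrite (gt_eqF L4) implybT.
    rewrite (_ : - 2^-1 + - 2^-1 = - 1); last by field.
    by rewrite powR_inv1// ltW.
  rewrite ler_wpM2r ?powR_ge0//; apply: ler_powRN => //.
  by rewrite ler_pM2r// ler_nat.
(* Scale invariance: the total exponent [-2 a - b + 2 d] is 0. *)
have spow :
    s k `^ (- a) * s k `^ (- a) * s k `^ (- b) * (s k ^+ d * s k ^+ d) = 1.
  rewrite -powR_mulrn// -!powRD; try by rewrite (gt_eqF (s_gt0 k)) implybT.
  rewrite (_ : _ + _ = 0) ?powRr0//.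
  by rewrite /b; ring.
have cE : c * ln 2 = c0 ^+ 2 * h `^ (- a) * 2 `^ (- b) * (rho * h) ^+ d *
    (rho * h * h) ^+ d by rewrite /c divfK ?gt_eqF.
apply: (@le_trans _ _ (c * ln 2 * (k.+4%:R * ln 2)^-1)).
  rewrite le_eqVlt; apply/orP; left; apply/eqP; rewrite invfM.
  by rewrite mulrACA mulfV ?mulr1// gt_eqF.
apply: (@le_trans _ _ (c * ln 2 * X)).
  apply: ler_wpM2l hr; rewrite cE.
  by rewrite !(mulr_ge0, exprn_ge0, powR_ge0)// ltW.
rewrite le_eqVlt; apply/orP; left; apply/eqP.
rewrite -[LHS]mulr1 -[X in _ * X = _]spow cE /X /M /m !sS.
rewrite (powRM _ (ltW h_gt0) sk0) (powRM _ _ sk0)//.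
move: (s k) => t; rewrite !exprMn.
move: (t `^ (- a)) (t `^ (- b)) (h `^ (- a)) (2 `^ (- b)).
move: (_ `^ (- 2^-1)) (_ `^ (- 2^-1)) => A1 A2 A3 A4 A5 A6.
by ring.
Qed.

Lemma rollnik_sqnorm_pinfty :
  rollnik_sqnorm a (@log_potential R d a g) = +oo%E.
Proof.
set mu := lebesgue_tuple R d.
have integral_B k (r : R) :
    (\int[mu]_(x in B k) r%:E)%E = (r * (rho * s k.+1) ^+ d)%:E.
  by rewrite integral_cst// EFinM; congr (_ * _)%E; exact: lebesgue_B.
apply/eqP; rewrite -leye_eq log_potentialE.
have mEK : measurable_fun setT (EFin \o K) by exact/measurable_EFinP.
have EK0 q : (0 <= (EFin \o K) q)%E by rewrite lee_fin.
have mEKx x : measurable_fun setT (fun y => (K (x, y))%:E).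
  exact: (measurable_fun_pair2 x mEK).
have mF : measurable_fun setT (fun x => \int[mu]_y (K (x, y))%:E)%E.
  exact: (measurable_fun_fubini_tonelli_F _ mEK EK0).
have F0 x : (0 <= \int[mu]_y (K (x, y))%:E)%E.
  by apply: integral_ge0 => y _; rewrite lee_fin.
have F_ge k x : B k x ->
    ((M k * (rho * s k.+2) ^+ d)%:E <= \int[mu]_y (K (x, y))%:E)%E.
  move=> Bx.
  apply: (@le_trans _ _ (\int[mu]_(y in B k.+1) (K (x, y))%:E)%E); last first.
    apply: ge0_subset_integral;
      [exact: mB|exact: measurableT|exact: mEKx| |by []].
    by move=> y _; exact: (EK0 (x, y)).
  apply: (@le_trans _ _ (\int[mu]_(y in B k.+1) (M k)%:E)%E).
    by rewrite integral_B.
  apply: ge0_le_integral.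
  - exact: mB.
  - by move=> y _; rewrite lee_fin.
  - exact: measurable_cst.
  - exact: (measurable_funTS (mEKx x)).
  - by move=> y By; rewrite lee_fin K_B_ge.
have cpos : 0 < c.
  by rewrite ?(divr_gt0, mulr_gt0, exprn_gt0, powR_gt0).
(* The factor 4 absorbs the shift of the index, since [k + 4 <= 4 (k + 1)]. *)
rewrite -(@nneseries_harmonic R (c / 4)); last by rewrite divr_gt0.
apply: (@le_trans _ _ (\sum_(0 <= k <oo) \int[mu]_(x in B k)
   (\int[mu]_y (K (x, y))%:E))%E).
  apply: lee_nneseries => [k _ _|k _].
    by rewrite lee_fin divr_ge0// ltW// divr_gt0.
  apply: (@le_trans _ _ (\int[mu]_(x in B k) (M k * (rho * s k.+2) ^+ d)%:E)%E).
    rewrite integral_B lee_fin (le_trans _ (term_ge k))//.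
    rewrite -mulrA ler_wpM2l ?(ltW cpos)// -invfM.
    rewrite lef_pV2 ?posrE ?mulr_gt0 ?ltr0n//.
    by rewrite -natrM ler_nat mulnS (@leq_add2l 4 k) leq_pmull.
  apply: ge0_le_integral.
  - exact: mB.
  - by move=> x _; rewrite lee_fin mulr_ge0// exprn_ge0// mulr_ge0// ltW.
  - exact: measurable_cst.
  - exact: (measurable_funTS mF).
  - by move=> x; exact: F_ge.
(* The boxes are disjoint, so the sum is the integral over their union, at most the full
   integral. *)
rewrite -ge0_integral_bigcup//; last exact: (measurable_funTS mF).
apply: ge0_subset_integral; [|exact: measurableT|exact: mF| |by []].
  exact: bigcup_measurable.
by move=> x _; exact: F0.
Qed.

End rollnik_lower.

Theorem proposition3p21 (R : realType) (d : nat) (alpha gamma : R)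
    (alpha02 : 0 < alpha < 2) (alpha_d : alpha < d%:R < 2 * alpha) :
  rollnik d alpha (log_potential alpha gamma) <-> 1 / 2 < gamma.
Proof.
move: alpha02 alpha_d => /andP[a0 _] /andP[ad da].
have d0 : (0 < d)%N by rewrite -(ltr0n R) (lt_trans a0).
split=> [[_]|g2].
  apply: contraTT; rewrite -leNgt div1r => g2.
  by rewrite rollnik_sqnorm_pinfty.
split; last exact: rollnik_sqnorm_lty.
apply: lebesgue_measurable_funW; rewrite log_potentialE.
exact: measurable_log_weight.
Qed.
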